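(* Let $A$ be a valuation ring with quotient field $L$, let $\widetilde{\mathfrak m}$ be a maximal ideal of the integral closure $I(A)$ of $A$ in the separable-algebraic closure $L^{\mathrm{sep}}$ of $L$, and let $F$ be a finite extension of $L$ contained in the absolute inertia field of $L$ with respect to $\widetilde{\mathfrak m}$. Let $A^*=F\cap I(A)$ be the integral closure of $A$ in $F$ and $B=A^*_{\widetilde{\mathfrak m}\cap A^*}$. Let $\eta\in B$ be an element such that $F=L(\eta)$, the monic minimal polynomial $h(X)$ of $\eta$ over $L$ lies in $A[X]$, and $\eta$ and $h'(\eta)$ are units in $B$. Then for every element $b\in B$ there exist elements $r,s\in B$, henselian over $A$, such that $b\in A[\eta,r,s]$.
   Context: The absolute inertia field of $L$ with respect to $\widetilde{\mathfrak m}$ is the subfield of $L^{\mathrm{sep}}$ of all elements fixed by the group $\{\sigma\in\mathrm{Gal}(L^{\mathrm{sep}}|L)\mid \forall x\in I(A):\ x-\sigma(x)\in\widetilde{\mathfrak m}\}$. For an extension $A\subseteq B$ of commutative rings with unity, an element $b\in B$ is called henselian over $A$ if there is a polynomial $g(X)\in A[X]$ (not necessarily monic) such that $g(b)=0$ and $g'(b)$ is a unit of $B$. *)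

(* Defs.v *)
From HB Require Import structures.
From mathcomp Require Import all_boot all_order all_algebra all_field.
From mathcomp Require Import boolp classical_sets.

Set Implicit Arguments.
Unset Strict Implicit.
Unset Printing Implicit Defensive.

Import GRing.Theory.

Local Open Scope classical_set_scope.
Local Open Scope ring_scope.

(* Subrings and ideals are Prop-valued sets; [in S] is the boolean predicate
   that mathcomp's closure conditions and polyOver expect. *)

(* A valuation ring of L; its field of fractions is then L. *)
Definition valuation_ring (L : fieldType) (A : set L) : Prop :=
  subring_closed [in A] /\ forall x : L, x != 0 -> A x \/ A x^-1.

Definition separable_over (L M : fieldType) (iota : {rmorphism L -> M}) (x : M)
  : Prop :=
  exists p : {poly L},
    [/\ irreducible_poly p, separable_poly p & root (map_poly iota p) x].

Definition separably_closed (M : fieldType) : Prop :=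
  forall p : {poly M}, separable_poly p -> (1 < size p)%N -> exists x, root p x.

Definition separable_closure (L M : fieldType) (iota : {rmorphism L -> M})
  : Prop :=
  (forall x : M, separable_over iota x) /\ separably_closed M.

(* The integral closure in M of the subring A of L. *)
Definition integral_closure (L M : fieldType) (iota : {rmorphism L -> M})
    (A : set L) : set M :=
  [set x | exists p : {poly L},
     [/\ p \is monic, p \is a polyOver [in A] & root (map_poly iota p) x]].

Definition ideal_of (R : comNzRingType) (S I : set R) : Prop :=
  [/\ I `<=` S, I 0, forall x y, I x -> I y -> I (x + y)
    & forall a x, S a -> I x -> I (a * x)].

Definition maximal_ideal_of (R : comNzRingType) (S m : set R) : Prop :=
  [/\ ideal_of S m, m <> S
    & forall J, ideal_of S J -> m `<=` J -> J = m \/ J = S].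

(* Gal(Ls|L) as a set of ring endomorphisms of Ls. *)
Definition galois_group (L Ls : fieldType) (iota : {rmorphism L -> Ls})
  : set {rmorphism Ls -> Ls} :=
  [set sigma : {rmorphism Ls -> Ls} | bijective sigma /\ forall c, sigma (iota c) = iota c].

Definition absolute_inertia_group (L Ls : fieldType)
    (iota : {rmorphism L -> Ls}) (A : set L) (m : set Ls)
  : set {rmorphism Ls -> Ls} :=
  [set sigma : {rmorphism Ls -> Ls} | galois_group iota sigma /\
     forall x, integral_closure iota A x -> m (x - sigma x)].

Definition absolute_inertia_field (L Ls : fieldType)
    (iota : {rmorphism L -> Ls}) (A : set L) (m : set Ls) : set Ls :=
  [set x | forall sigma : {rmorphism Ls -> Ls},
     absolute_inertia_group iota A m sigma -> sigma x = x].

(* The localization of the subring S at its prime ideal S `&` p, inside F. *)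
Definition localization (F : fieldType) (S p : set F) : set F :=
  [set x | exists a s, [/\ S a, S s, ~ p s & x = a / s]].

Definition unit_of (R : comNzRingType) (S : set R) (x : R) : Prop :=
  S x /\ exists2 y, S y & x * y = 1.

(* b is henselian over A in the extension of A by B, where A is viewed in B
   through f. *)
Definition henselian_over (R S : comNzRingType) (f : {rmorphism R -> S})
    (A : set R) (B : set S) (b : S) : Prop :=
  exists g : {poly R},
    [/\ g \is a polyOver [in A], (map_poly f g).[b] = 0
      & unit_of B (map_poly f g^`()).[b]].

(* A[X], the subring generated by the image of A and by X. *)
Definition adjoin_set (R S : comNzRingType) (f : {rmorphism R -> S})
    (A : set R) (X : set S) : set S :=
  smallest (fun T : set S => subring_closed [in T]) (f @` A `|` X).

(* Main.v *)
Require Import Defs.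
From HB Require Import structures.
From mathcomp Require Import all_boot all_order all_algebra all_field.
From mathcomp Require Import boolp classical_sets.
From mathcomp Require Import ring.

Set Implicit Arguments.
Unset Strict Implicit.
Unset Printing Implicit Defensive.

Import GRing.Theory.

Local Open Scope classical_set_scope.
Local Open Scope ring_scope.

(* Since h'(eta) A* lies in A[eta], every b in B is a quotient p(eta) / u(eta)
   with p and u in A[X] and u(eta) a unit of B. Working with the maximal ideals
   of A[X] that consist of the polynomials vanishing modulo m at a given
   conjugate of eta, the Chinese remainder theorem provides w in A[X] such that
   a = u(eta) w(eta) is a unit of B that is not congruent modulo m to
   u(z) w(z), for any root z <> eta of h. Hence the derivative at a of the
   characteristic polynomial of a is not in m, so that r = 1/a, a root of the
   reversed polynomial, is henselian over A; and b = p(eta) w(eta) r, whence one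
   may take s = r. *)

(** * Polynomial values modulo a prime ideal of integral elements *)

Definition integral_elements (R K : nzRingType) (f : R -> K) : set K :=
  [set x | integralOver f x].

Section IdealOfIntegralElements.

Variables (R : comNzRingType) (K : fieldType) (f : {rmorphism R -> K}).
Variable m : set K.
Local Notation O := (integral_elements f).
Local Notation "p ^f" := (map_poly f p) : ring_scope.
Hypothesis m_ideal : ideal_of O m.

Lemma ideal_sum (I : Type) (r : seq I) (P : pred I) (F : I -> K) :
  (forall i, P i -> m (F i)) -> m (\sum_(i <- r | P i) F i).
Proof. by case: m_ideal => _ m0 mD _ mF; apply: big_ind. Qed.

Lemma idealM x y : O x -> m y -> m (x * y).
Proof. by case: m_ideal => _ _ _; apply. Qed.

Lemma idealMr x y : O y -> m x -> m (x * y).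
Proof. by rewrite mulrC; apply: idealM. Qed.

Lemma idealD x y : m x -> m y -> m (x + y).
Proof. by case: m_ideal => _ _ mD _; apply: mD. Qed.

Lemma idealN x : m x -> m (- x).
Proof. by rewrite -mulN1r; apply: idealM; apply/integral_opp/integral1. Qed.

Lemma idealB x y : m x -> m y -> m (x - y).
Proof. by move=> mx /idealN; apply: idealD. Qed.

Lemma integral_map_horner (p : {poly R}) y : O y -> O (p^f).[y].
Proof.
apply: integral_horner; apply/integral_poly => i.
by rewrite coef_map; apply: integral_id.
Qed.

Hypothesis m1 : ~ m 1.
Hypothesis m_prime : forall x y, O x -> O y -> m (x * y) -> m x \/ m y.
Hypothesis m_unit : forall a, ~ m (f a) -> exists c, a * c = 1.

(** Modulo [m], [y] is algebraic over the residue field of [R], so its inverse is a polynomial in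
    it. The induction strips constant coefficients lying in [m], dividing the relation by [y]; the
    first one outside [m] is invertible and yields the inverse. *)
Lemma poly_inverse_mod p y :
    O y -> ~ m y -> m (p^f).[y] -> (exists k, ~ m (f p`_k)) ->
  exists v : {poly R}, m (y * (v^f).[y] - 1).
Proof.
move=> Oy my; elim/poly_ind: p => [|p c IHp].
  by move=> _ [k []]; rewrite coef0 rmorph0; case: m_ideal.
rewrite rmorphD rmorphM /= map_polyX map_polyC !hornerE => mpc [k mk].
have [mc|/m_unit[d cd]] := pselect (m (f c)); last first.
  exists (- d *: p); rewrite map_polyZ hornerZ rmorphN.
  have -> : y * (- f d * (p^f).[y]) - 1 = - f d * ((p^f).[y] * y + f c).
    rewrite mulrDr -{1}(rmorph1 f) -cd rmorphM; ring.
  by apply: idealM => //; rewrite -rmorphN; apply: integral_id.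
apply: IHp.
  have mpy : m ((p^f).[y] * y) by rewrite -[_ * y](addrK (f c)); apply: idealB.
  by case: (m_prime (integral_map_horner p Oy) Oy mpy).
case: k mk => [|k]; rewrite coefD coefMX coefC /= ?add0r ?addr0 => mk //.
by exists k.
Qed.

(** The value [p(y)] satisfies a monic equation, whose leading coefficient is outside [m]; its
    inverse, a polynomial in [p(y)], becomes one in [y] by composition. *)
Lemma poly_value_inverse_mod (p : {poly R}) y : O y -> ~ m (p^f).[y] ->
  exists v : {poly R}, m ((p * v)^f.[y] - 1).
Proof.
move=> Oy mpy; have Opy := integral_map_horner p Oy.
have [q q_monic /rootP qpy0] := Opy.
have [|| v mv] := poly_inverse_mod (p := q) Opy mpy.
- by rewrite qpy0; case: m_ideal.
- by exists (size q).-1; rewrite -lead_coefE (monicP q_monic) rmorph1.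
by exists (v \Po p); rewrite rmorphM hornerM /= map_comp_poly horner_comp.
Qed.

(* Maximality of the kernels of A[X] -> I(A)/m. *)
Lemma vanishing_mod_sym (x y : K) : O x -> O y ->
    (forall g : {poly R}, m (g^f).[y] -> m (g^f).[x]) ->
  forall g : {poly R}, m (g^f).[x] -> m (g^f).[y].
Proof.
move=> Ox Oy yx g mgx; apply: contrapT => /(poly_value_inverse_mod Oy)[v].
have eval1 z : (g * v)^f.[z] - 1 = ((g * v - 1)^f).[z].
  by rewrite rmorphB rmorph1 !hornerE.
(* [g * v - 1] vanishes modulo [m] at [y], hence at [x], where [g] vanishes too; this forces 1 into
   [m]. *)
rewrite eval1 => /yx; rewrite -eval1 rmorphM hornerM => mB; apply: m1.
rewrite -[1](subKr ((g^f).[x] * (v^f).[x])); apply: idealB => //.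
exact/idealMr/mgx/integral_map_horner.
Qed.

(** [e] is a product of factors, one for each [z] not conjugate to [x] over the residue field, that
    vanish modulo [m] at [z] but not at [x]. *)
Lemma separating_poly (x : K) (rs : seq K) :
    O x -> (forall z, z \in rs -> O z) ->
  exists2 e : {poly R}, ~ m (e^f).[x] & forall z, z \in rs ->
    m (e^f).[z] \/ forall g : {poly R}, m (g^f).[x] -> m (g^f).[z].
Proof.
move=> Ox; elim: rs => [|z rs IHrs] Ors.
  by exists 1; rewrite ?rmorph1 ?hornerE.
have [|e me ePrs] := IHrs; first by move=> t t_rs; apply: Ors; rewrite inE t_rs orbT.
have Oz : O z by apply: Ors; rewrite mem_head.
have [zx|/existsNP[g /not_implyP[mgz mgx]]] :=
    pselect (forall g : {poly R}, m (g^f).[z] -> m (g^f).[x]).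
  exists e => // t; rewrite inE => /orP[/eqP->|/ePrs//].
  by right; apply: vanishing_mod_sym.
exists (e * g).
  by rewrite rmorphM hornerM => /m_prime[]//; apply: integral_map_horner.
move=> t; rewrite inE rmorphM hornerM => /orP[/eqP->|t_rs].
  by left; apply: idealM => //; apply: integral_map_horner.
have [met|xt] := ePrs t t_rs; last by right.
by left; apply: idealMr => //; apply/integral_map_horner/Ors; rewrite inE t_rs orbT.
Qed.

(* By the Chinese remainder theorem in A[X], a multiple of [u] is congruent to
   [x] at the roots congruent to a conjugate of [x] over the residue field,
   and to 0 at the other ones. *)
Lemma multiple_with_distinct_values (u : {poly R}) (x : K) (rs : seq K) :
    O x -> ~ m x -> (forall z, z \in rs -> O z) ->
    (forall z, z \in rs -> ~ m (x - z)) -> ~ m (u^f).[x] ->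
  exists2 w : {poly R}, ~ m ((u * w)^f).[x] &
    forall z, z \in rs -> ~ m (((u * w)^f).[x] - ((u * w)^f).[z]).
Proof.
move=> Ox mx Ors mrs mux.
have [e mex eP] := separating_poly Ox Ors.
have [|v mv] := poly_value_inverse_mod (p := u * e) Ox.
  by rewrite rmorphM hornerM => /m_prime[]//; apply: integral_map_horner.
have {}mv : m ((u * e * v - 1)^f).[x] by rewrite rmorphB rmorph1 !hornerE.
(* [G] vanishes modulo [m] at [x], hence at its conjugates, and [u * w] will be [(G + 1) * 'X]: it
   is congruent to the point itself there, while the factor [e] kills it elsewhere. *)
pose G := u * e * v - 1.
have uwE z : ((u * (e * v * 'X))^f).[z] = ((G^f).[z] + 1) * z.
  rewrite (_ : u * _ = (G + 1) * 'X); last by rewrite /G; ring.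
  by rewrite rmorphM rmorphD rmorph1 /= map_polyX !hornerE.
have mGx : m ((G^f).[x] * x) by apply: idealMr.
exists (e * v * 'X).
  by rewrite uwE mulrDl mul1r => /idealB/(_ mGx); rewrite addrC addKr.
move=> z z_rs; have Oz := Ors _ z_rs.
have [mez|xz] := eP _ z_rs; last first.
  have mGz : m ((G^f).[z] * z) by apply/idealMr/xz.
  rewrite !uwE => /idealB/(_ mGx)/idealD/(_ mGz) mB; apply: (mrs _ z_rs).
  by congr m : mB; ring.
have mB : m ((u * (e * v * 'X))^f).[z].
  rewrite mulrCA -mulrA rmorphM hornerM; apply: idealMr => //.
  exact: integral_map_horner.
move=> /idealD/(_ mB); rewrite subrK uwE => /idealB/(_ mGx) mx'.
by apply: mx; congr m : mx'; ring.
Qed.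

End IdealOfIntegralElements.

(** * Maximal ideals of the ring of integral elements *)

Section MaximalIdeal.

Variables (R : comNzRingType) (K : fieldType) (f : {rmorphism R -> K}).
Variable m : set K.
Local Notation O := (integral_elements f).
Hypothesis m_max : maximal_ideal_of O m.

Lemma maximal_ideal_proper : ~ m 1.
Proof.
case: m_max => -[mO _ _ mM] mNO _ m1; apply: mNO.
by apply/seteqP; split => // x Ox; rewrite -(mulr1 x); apply: mM.
Qed.

Lemma maximal_ideal_inverse x : O x -> ~ m x -> exists2 z, O z & m (1 - x * z).
Proof.
case: m_max => -[mO m0 mD mM] mNO mJ Ox mx.
pose J := [set t | exists a b, [/\ m a, O b & t = a + x * b]].
have J_ideal : ideal_of O J.
  split=> [_ [a [b [ma Ob ->]]]| |_ _ [a [b [ma Ob ->]]] [c [d [mc Od ->]]]|].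
  - by apply: integral_add; [exact: mO | exact: integral_mul].
  - by exists 0, 0; split=> //; [apply: integral0 | ring].
  - exists (a + c), (b + d); split; [exact: mD | exact: integral_add | ring].
  move=> e _ Oe [a [b [ma Ob ->]]]; exists (e * a), (e * b).
  by split; [exact: mM | exact: integral_mul | ring].
have mJ' : m `<=` J.
  by move=> a ma; exists a, 0; split=> //; [apply: integral0 | ring].
have [JE|JE] := mJ J J_ideal mJ'.
  case: mx; rewrite -JE; exists 0, 1.
  by split=> //; [apply: integral1 | ring].
have [a [b [ma Ob E1]]] : J 1 by rewrite JE; apply: integral1.
by exists b => //; rewrite E1 addrK.
Qed.

Lemma maximal_ideal_prime x y : O x -> O y -> m (x * y) -> m x \/ m y.
Proof.
case: (m_max) => m_ideal _ _ Ox Oy mxy.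
have [|mx] := pselect (m x); [by left | right].
have [z Oz mz] := maximal_ideal_inverse Ox mx.
have -> : y = y * (1 - x * z) + x * y * z by ring.
by apply: (idealD m_ideal); [apply: (idealM m_ideal) | apply: (idealMr m_ideal)].
Qed.

(** Locality of [R]: every non-unit lies in the Jacobson radical. *)
Hypothesis R_local :
  forall a c : R, (exists d, a * d = 1) \/ (exists d, (1 + a * c) * d = 1).

(* Multiplying an equation of degree [n] for the inverse [z] of [a] modulo [m]
   by [a ^+ n] shows that [m] contains an element of [1 + a R]. *)
Lemma maximal_ideal_lies_over a : ~ m (f a) -> exists c, a * c = 1.
Proof.
case: (m_max) => m_ideal _ _ ma.
have [z Oz mz] := maximal_ideal_inverse (integral_id f a) ma.
have [p p_monic /rootP pz0] := Oz.
have p_n : size p = (size p).-1.+1 by rewrite prednK ?size_poly_gt0 ?monic_neq0.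
set n := (size p).-1 in p_n.
(* [1 + a * c] is the sum of the [p_k a^(n-k)]; the term 1 comes from the leading coefficient. *)
pose c := \sum_(k < n) p`_k * a ^+ (n - k.+1).
have [//|[d cd]] := R_local a c; case: maximal_ideal_proper.
rewrite -(rmorph1 f) -cd rmorphM /=; apply: (idealMr m_ideal).
  exact: integral_id.
(* Subtracting [a^n p(z) = 0] termwise leaves factors [1 - (a z)^k], all multiples of [1 - a z],
   which is in [m]. *)
have -> : f (1 + a * c) =
    \sum_(k < n.+1) f p`_k * f a ^+ (n - k) * (1 - (f a * z) ^+ k).
  transitivity (f (1 + a * c) - f a ^+ n * (map_poly f p).[z]).
    by rewrite pz0 mulr0 subr0.
  rewrite horner_coef size_map_poly_id0; last first.
    by rewrite (monicP p_monic) rmorph1 oner_neq0.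
  rewrite p_n [f a ^+ n * _]mulr_sumr.
  have -> : f (1 + a * c) = \sum_(k < n.+1) f p`_k * f a ^+ (n - k).
    rewrite big_ord_recr /= subnn expr0 mulr1 -lead_coefE (monicP p_monic).
    rewrite rmorphD rmorph1 addrC; congr (_ + _); rewrite mulr_sumr rmorph_sum.
    apply: eq_bigr => k _; rewrite !rmorphM /= rmorphXn /= mulrCA -exprS.
    by rewrite subnSK.
  rewrite -sumrB; apply: eq_bigr => k _.
  have -> : f a ^+ n = f a ^+ (n - k) * f a ^+ k.
    by rewrite -exprD subnK // -ltnS.
  rewrite coef_map /= exprMn; ring.
apply: (ideal_sum m_ideal) => k _; apply: (idealM m_ideal).
  apply: integral_mul; first exact: integral_id.
  by rewrite -rmorphXn; apply: integral_id.
rewrite -opprB subrX1 -mulNr opprB; apply: (idealMr m_ideal) => //.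
rewrite -(big_mkord xpredT (fun i => (f a * z) ^+ i)); apply: big_ind => [||i _].
- exact: integral0.
- exact: integral_add.
elim: i => [|i IHi]; first exact: integral1.
by rewrite exprS; do 2?apply: integral_mul => //; apply: integral_id.
Qed.

End MaximalIdeal.

(** * Polynomials given by their roots: coefficients and derivatives *)

(* The characteristic polynomial of the multiplication by [u] modulo [h]: the
   Vandermonde matrix of the roots diagonalises it. *)
Lemma poly_of_root_values (R : comNzRingType) (K : fieldType)
    (f : {rmorphism R -> K}) (h : {poly R}) (rs : seq K) (u : {poly R}) :
    h \is monic -> uniq rs -> map_poly f h = \prod_(z <- rs) ('X - z%:P) ->
  exists2 p : {poly R}, p \is monic &
    map_poly f p = \prod_(z <- rs) ('X - ((map_poly f u).[z])%:P).
Proof.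
move=> h_monic rs_uniq hE; pose n := size rs.
have size_h : size h = n.+1.
  have := congr1 (fun p : {poly K} => size p) hE.
  rewrite size_prod_XsubC size_map_poly_id0 // (monicP h_monic).
  by rewrite rmorph1 oner_neq0.
(* Row [i] of [N] holds the coefficients of ['X^i * u] reduced modulo [h]. Column [k] of [V]
   evaluates at a root of [h], where this reduction changes nothing. *)
pose rem i := Pdiv.CommonRing.rmodp ('X^i * u) h.
pose N : 'M[R]_n := \matrix_(i, j) (rem i)`_j.
pose V : 'M[K]_n := Vandermonde n (\row_i rs`_i).
pose D : 'rV[K]_n := \row_i (map_poly f u).[rs`_i].
have NV : map_mx f N *m V = V *m diag_mx D.
  apply/matrixP => i k; rewrite mul_mx_diag !mxE.
  have h_rs : (map_poly f h).[rs`_k] = 0.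
    by apply/rootP; rewrite hE root_prod_XsubC mem_nth.
  transitivity (map_poly f (rem i)).[rs`_k].
    rewrite (horner_coef_wide (n := n)); last first.
      apply: leq_trans (size_poly _ _) _.
      rewrite -ltnS -size_h Pdiv.CommonRing.ltn_rmodp.
      exact: monic_neq0.
    by apply: eq_bigr => j _; rewrite coef_map !mxE.
  have /(congr1 (fun p => (map_poly f p).[rs`_k])) :=
    Pdiv.RingMonic.rdivp_eq h_monic ('X^i * u).
  rewrite rmorphD !rmorphM /= map_polyXn !hornerE h_rs mulr0 add0r.
  by rewrite -/(rem i) => <-; rewrite mulrC.
have V_unit : V \in unitmx.
  rewrite unitmxE det_Vandermonde unitfE; apply/prodf_neq0 => i _.
  apply/prodf_neq0 => k lt_ik; rewrite !mxE subr_eq0 nth_uniq //.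
  by rewrite neq_ltn lt_ik orbT.
exists (char_poly N); first exact: char_poly_monic.
rewrite map_char_poly.
have -> : map_mx f N = V *m diag_mx D *m invmx V by rewrite -NV mulmxK.
transitivity (char_poly (diag_mx D)).
  rewrite /char_poly /char_poly_mx; set W := map_mx polyC V.
  have W_V : W *m map_mx polyC (invmx V) = 1%:M.
    by rewrite -map_mxM mulmxV // map_mx1.
  have -> : 'X%:M - map_mx polyC (V *m diag_mx D *m invmx V) =
            W *m ('X%:M - map_mx polyC (diag_mx D)) *m map_mx polyC (invmx V).
    rewrite mulmxBr mulmxBl !map_mxM; congr (_ - _).
    by rewrite scalar_mxC -mulmxA W_V mulmx1.
  by rewrite !det_mulmx mulrAC -det_mulmx W_V det1 mul1r.
rewrite char_poly_trig ?diag_mx_is_trig // (big_nth 0) big_mkord.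
by apply: eq_bigr => i _; rewrite !mxE eqxx.
Qed.

Lemma horner_deriv_prod_XsubC (K : fieldType) (rs : seq K) z :
    uniq rs -> z \in rs ->
  (\prod_(t <- rs) ('X - t%:P))^`().[z] =
  (\prod_(t <- rs | t != z) ('X - t%:P)).[z].
Proof.
move=> rs_uniq z_rs; rewrite (bigD1_seq z) //= derivM derivXsubC !hornerE.
by rewrite subrr mul0r addr0.
Qed.

(** * Integrality of remainders modulo [h] *)

Section Integrality.

Variables (R : comNzRingType) (K : fieldType) (f : {rmorphism R -> K}).

(** Boolean form of integrality, as [polyOver] and the [rpred] lemmas expect. *)
Definition integral_pred : {pred K} := fun x => `[< integralOver f x >].

Lemma integral_predP x : reflect (integralOver f x) (x \in integral_pred).
Proof. exact: asboolP. Qed.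

Lemma integral_pred_subring : subring_closed integral_pred.
Proof.
split=> [|x y|x y]; first exact/integral_predP/integral1.
  by move=> /integral_predP ? /integral_predP ?; apply/integral_predP/integral_sub.
by move=> /integral_predP ? /integral_predP ?; apply/integral_predP/integral_mul.
Qed.

HB.instance Definition _ :=
  GRing.isSubringClosed.Build K integral_pred integral_pred_subring.

(* Lagrange interpolation at the roots of [h] expresses the remainder with
   coefficients that are integral. *)
Lemma integral_modp_deriv (L : fieldType) (iota : {rmorphism L -> K})
    (h g : {poly L}) (rs : seq K) :
    uniq rs -> map_poly iota h = \prod_(z <- rs) ('X - z%:P) ->
    (forall z, z \in rs -> integralOver f z) ->
    (forall z, z \in rs -> integralOver f (map_poly iota g).[z]) ->
  forall k, integralOver f (iota ((g * h^`()) %% h)`_k).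
Proof.
move=> rs_uniq hE rs_int g_int k.
set gh := map_poly iota g; pose H z := \prod_(t <- rs | t != z) ('X - t%:P).
have size_h : size h = (size rs).+1.
  by rewrite -(size_map_poly iota) hE size_prod_XsubC.
have h_n0 : h != 0 by rewrite -size_poly_gt0 size_h.
have size_H z : z \in rs -> size (H z) = size rs.
  move=> z_rs; rewrite /H -big_filter size_prod_XsubC -rem_filter // size_rem //.
  by case: (rs) z_rs.
have H_root z t : z \in rs -> t \in rs -> t != z -> (H z).[t] = 0.
  move=> z_rs t_rs tz; apply/rootP.
  by rewrite /H -big_filter root_prod_XsubC mem_filter tz.
(* Interpolating [g * h'] would need the denominators [(H z).[z] = h'(z)], but they cancel against
   the values [g(z) h'(z)]; hence [T] has integral coefficients. *)
pose T := \sum_(z <- rs) gh.[z] *: H z.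
have -> : iota ((g * h^`()) %% h)`_k = T`_k.
  rewrite -coef_map; congr (polyseq _)`_k; apply/subr0_eq.
  apply: (@roots_geq_poly_eq0 _ _ rs) => //; last first.
    apply: leq_trans (size_polyD _ _) _; rewrite size_polyN geq_max size_map_poly.
    rewrite -ltnS -size_h ltn_modp h_n0 /=.
    rewrite /T big_seq; apply: (big_ind (fun p : {poly K} => size p <= size rs)%N).
    - by rewrite size_poly0.
    - move=> p q ? ?; apply: leq_trans (size_polyD _ _) _.
      by rewrite geq_max; apply/andP.
    - move=> z z_rs; apply: leq_trans (size_scale_leq _ _) _.
      by rewrite size_H.
  apply/allP => z z_rs; rewrite /root !hornerE.
  have -> : T.[z] = gh.[z] * (map_poly iota h)^`().[z].
    rewrite hE horner_deriv_prod_XsubC // horner_sum (bigD1_seq z) //= hornerZ.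
    rewrite [X in _ + X]big_seq_cond big1 ?addr0 // => t /andP[t_rs tz].
    by rewrite hornerZ H_root ?mulr0 // eq_sym.
  have /(congr1 (fun p => (map_poly iota p).[z])) := divp_eq (g * h^`()) h.
  rewrite rmorphD !rmorphM /= !hornerE deriv_map => ->.
  have /rootP-> : root (map_poly iota h) z by rewrite hE root_prod_XsubC.
  by rewrite mulr0 add0r subrr.
apply/integral_predP.
suff /polyOverP : T \is a polyOver integral_pred by [].
rewrite /T big_seq; apply: rpred_sum => z z_rs; apply: polyOverZ.
  exact/integral_predP/g_int.
rewrite /H big_seq_cond; apply: rpred_prod => t /andP[t_rs _].
by rewrite polyOverXsubC; apply/integral_predP/rs_int.
Qed.

End Integrality.

(** * Reversed polynomials [X^n p(1/X)], with [n] the degree of [p] *)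

Definition reverse_poly (R : nzRingType) (p : {poly R}) : {poly R} :=
  \sum_(k < size p) p`_k *: 'X^((size p).-1 - k).

Lemma map_reverse_poly (R S : nzRingType) (f : {rmorphism R -> S}) (p : {poly R}) :
  injective f -> map_poly f (reverse_poly p) = reverse_poly (map_poly f p).
Proof.
move=> f_inj; rewrite /reverse_poly rmorph_sum size_map_inj_poly ?rmorph0 //.
by apply: eq_bigr => k _; rewrite /= map_polyZ map_polyXn coef_map.
Qed.

Lemma horner_reverse_poly (K : fieldType) (p : {poly K}) x : x != 0 ->
  x ^+ (size p).-1 * (reverse_poly p).[x^-1] = p.[x].
Proof.
move=> x0; rewrite horner_sum mulr_sumr [RHS]horner_coef.
apply: eq_bigr => -[k /= lt_k] _.
have le_k : (k <= (size p).-1)%N by case: size lt_k.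
rewrite hornerZ hornerXn mulrCA -{1}(subnKC le_k) exprD exprVn.
by rewrite mulfK // expf_neq0.
Qed.


(** Differentiating [X^n p(1/X)] gives [n X^(n-1) p(1/X) - X^(n-2) p'(1/X)], whose first term
    vanishes at [1/x] because [p(x) = 0]. *)
Lemma horner_deriv_reverse_poly (K : fieldType) (p : {poly K}) x :
    x != 0 -> root p x ->
  x ^+ (size p).-1 * (reverse_poly p)^`().[x^-1] = - x ^+ 2 * p^`().[x].
Proof.
move=> x0 /rootP px0; set n := (size p).-1.
have xV0 : x^-1 != 0 by rewrite invr_eq0.
suff E : x^-1 * (x ^+ n * (reverse_poly p)^`().[x^-1]) = - (x * p^`().[x]).
  by rewrite -[LHS](mulVKf x0) E expr2; ring.
(* Adding [n p(x) = 0] produces the weights [n - k] that the derivative of the reversed polynomial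
   carries. *)
have -> : - (x * p^`().[x]) = \sum_(k < size p) (p`_k * x ^+ k) *+ (n - k).
  transitivity (p.[x] *+ n - x * p^`().[x]); first by rewrite px0 mul0rn sub0r.
  have -> : p^`() = \sum_(k < size p) p`_k *: 'X^(k.-1) *+ k.
    rewrite -{1}[p]coefK poly_def raddf_sum; apply: eq_bigr => k _ /=.
    by rewrite derivZ derivXn scalerMnr.
  rewrite horner_coef -sumrMnl horner_sum mulr_sumr -sumrB.
  apply: eq_bigr => -[k /= lt_k] _.
  have le_k : (k <= n)%N by rewrite /n; case: size lt_k.
  rewrite mulrnBr // hornerMn hornerZ hornerXn mulrnAr; congr (_ - _).
  by case: k {lt_k le_k} => [|k]; rewrite ?mulr0n // mulrCA -exprS.
rewrite /reverse_poly raddf_sum horner_sum !mulr_sumr /=.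
apply: eq_bigr => -[k /= lt_k] _.
have le_k : (k <= n)%N by rewrite /n; case: size lt_k.
rewrite derivZ derivXn hornerZ hornerMn hornerXn.
case E : (n - k)%N => [|i]; first by rewrite !mulr0n !mulr0.
rewrite -mulrnAr; rewrite !mulrnAr; congr (_ *+ _).
rewrite -(subnKC le_k) E exprD exprVn /=.
rewrite exprS; field.
by rewrite x0 expf_neq0.
Qed.

(** * Splitting over a separably closed field *)

Lemma separably_closed_split (M : fieldType) (p : {poly M}) :
    separably_closed M -> p \is monic -> separable_poly p ->
  exists rs : seq M, p = \prod_(z <- rs) ('X - z%:P).
Proof.
move=> M_closed; have [n] := ubnP (size p).
elim: n p => // n IHn p le_pn p_monic p_sep.
have [p_gt1|p_le1] := ltnP 1 (size p); last first.
  exists nil; rewrite big_nil; move: p_monic.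
  by rewrite (size1_polyC p_le1) monicE lead_coefC => /eqP->.
have [x /factor_theorem[q pE]] := M_closed p p_sep p_gt1.
have q_monic : q \is monic by move: p_monic; rewrite pE monicMr ?monicXsubC.
have [|||rs qE] := IHn q => //.
- by move: le_pn; rewrite pE size_Mmonic ?monicXsubC ?monic_neq0 // size_XsubC addn2.
- by move: p_sep; rewrite pE separable_mul => /and3P[].
by exists (x :: rs); rewrite big_cons mulrC -qE.
Qed.

(** * Valuation rings as types: locality and integral closedness *)

Section ValuationRing.

Variables (L : fieldType) (A : set L).

(** The closure proof is an argument of the type, so that the ring structure can be inferred from
    the type alone. *)
Definition subring_elt of subring_closed [in A] : Type := {x : L | x \in A}.

Hypothesis A_subring : subring_closed [in A].
Local Notation R := (subring_elt A_subring).

HB.instance Definition _ := SubChoice.copy R {x : L | x \in A}.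
HB.instance Definition _ :=
  GRing.SubChoice_isSubComNzRing.Build L [in A] R A_subring.

Definition incl (x : R) : L := \val x.
Arguments incl : simpl never.

HB.instance Definition _ := GRing.RMorphism.copy incl (\val : R -> L).

Lemma incl_inj : injective incl. Proof. exact: val_inj. Qed.

Lemma inclP (x : R) : A (incl x). Proof. exact/set_mem/valP. Qed.

Lemma incl_onto (x : L) : A x -> exists a, incl a = x.
Proof. by move=> /mem_set Ax; exists (Sub x Ax); apply: SubK. Qed.

Lemma lift_polyOver (p : {poly L}) :
  p \is a polyOver [in A] -> exists q : {poly R}, map_poly incl q = p.
Proof.
move=> /(all_nthP 0) pA; exists (\poly_(i < size p) insubd (0 : R) p`_i).
apply/polyP => i; rewrite coef_map coef_poly.
case: ltnP => [lt_i|le_i]; last by rewrite raddf0 nth_default.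
exact/insubdK/pA.
Qed.

Lemma polyOver_map_incl (p : {poly R}) : map_poly incl p \is a polyOver [in A].
Proof. by apply: polyOver_poly => i _; apply: valP. Qed.

Lemma monic_map_incl (p : {poly R}) : (map_poly incl p \is monic) = (p \is monic).
Proof. by rewrite !monicE lead_coef_map_inj //; apply: val_inj. Qed.

(** Passes from polynomials over [L] with coefficients in [A] to polynomials over the type of [A],
    so that the results on integral elements apply. *)
Lemma integral_closureE (M : fieldType) (iota : {rmorphism L -> M}) :
  integral_closure iota A = integral_elements (iota \o incl).
Proof.
apply/seteqP; split => x [p].
  move=> [p_monic /lift_polyOver[q qp] px].
  exists q; last by rewrite map_poly_comp qp.
  by rewrite -monic_map_incl qp.
move=> p_monic; rewrite map_poly_comp => px; exists (map_poly incl p); split=> //.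
  by rewrite monic_map_incl.
exact: polyOver_map_incl.
Qed.

Hypothesis A_val : forall x : L, x != 0 -> A x \/ A x^-1.

Lemma valuation_ring_dvd_total (a b : R) :
  (exists c, a = b * c) \/ (exists c, b = a * c).
Proof.
have [a0|a0] := eqVneq a 0; first by left; exists 0; rewrite mulr0.
have [b0|b0] := eqVneq b 0; first by right; exists 0; rewrite mulr0.
have va0 : incl a != 0 by [].
have vb0 : incl b != 0 by [].
have := A_val (mulf_neq0 va0 (invr_neq0 vb0)).
rewrite invf_div => -[] /incl_onto[c cE].
  by left; exists c; apply: incl_inj; rewrite rmorphM /= cE mulrC divfK.
by right; exists c; apply: incl_inj; rewrite rmorphM /= cE mulrC divfK.
Qed.

(** One of [a] and [1 + a * c] divides the other, and together they generate the unit ideal; so the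
    divisor is a unit. *)
Lemma valuation_ring_local (a c : R) :
  (exists d, a * d = 1) \/ (exists d, (1 + a * c) * d = 1).
Proof.
have [[e aE]|[e eE]] := valuation_ring_dvd_total a (1 + a * c).
  right; exists (1 - e * c); rewrite mulrBr mulr1 mulrA -aE; ring.
by left; exists (e - c); rewrite mulrBr -eE; ring.
Qed.

(** If [x] is not in [A], then [y = 1/x] is; dividing the monic equation of degree [n + 1] by [x^n]
    writes [x] as a polynomial in [y] over [A]. *)
Lemma valuation_ring_integrally_closed (x : L) :
  integralOver incl x -> A x.
Proof.
case=> p p_monic /rootP px0.
have [->|x0] := eqVneq x 0; first by rewrite -(rmorph0 incl); apply: inclP.
have [//|/incl_onto[y yE]] := A_val x0.
have size_p : size (map_poly incl p) = size p.
  by rewrite size_map_poly_id0 // (monicP p_monic) oner_neq0.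
case sp: (size p) => [|[|n]].
- by have := monic_neq0 p_monic; rewrite -size_poly_gt0 sp.
- move: px0 p_monic; rewrite (size1_polyC (eq_leq sp)) map_polyC hornerC.
  rewrite monicE lead_coefC.
  by move=> /[swap] /eqP->; move/eqP: (oner_neq0 L).
have lead : p`_n.+1 = 1 by rewrite -(monicP p_monic) lead_coefE sp.
suff -> : x = incl (- \sum_(k < n.+1) p`_k * y ^+ (n - k)) by apply: inclP.
have := congr1 ( *%R (x^-1 ^+ n)) px0.
rewrite horner_coef size_p sp big_ord_recr /= coef_map /= lead rmorph1 mul1r.
rewrite mulr0 mulrDr exprS mulrCA -exprMn mulVf // expr1n mulr1 addrC => /eqP.
rewrite addr_eq0 => /eqP xE; rewrite [LHS]xE rmorphN; congr (- _).
rewrite rmorph_sum mulr_sumr.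
apply: eq_bigr => -[k /= lt_k] _; have le_k : (k <= n)%N by [].
rewrite coef_map rmorphM rmorphXn /= yE -{1}(subnK le_k) exprD mulrCA -mulrA.
by rewrite -exprMn mulVf // expr1n mulr1.
Qed.

End ValuationRing.

(** * Henselian generators for the elements of [B] *)

Theorem theorem1p4
  (L Ls : fieldType) (iota : {rmorphism L -> Ls})
  (Ls_sep : separable_closure iota)
  (A : set L) (A_val : valuation_ring A)
  (m : set Ls) (m_max : maximal_ideal_of (integral_closure iota A) m)
  (F : fieldExtType L) (j : {rmorphism F -> Ls})
  (j_iota : forall c : L, j c%:A = iota c)
  (F_inertia : range j `<=` absolute_inertia_field iota A m)
  (Astar : set F) (Astar_def : Astar = j @^-1` integral_closure iota A)
  (B : set F) (B_def : B = localization Astar (j @^-1` m))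
  (eta : F) (eta_B : B eta) (F_gen : <<1; eta>>%VS = fullv)
  (h : {poly L}) (h_minPoly : map_poly (in_alg F) h = minPoly 1 eta)
  (h_A : h \is a polyOver [in A])
  (eta_unit : unit_of B eta)
  (dh_unit : unit_of B (map_poly (in_alg F) h^`()).[eta]) :
  forall b : F, B b ->
    exists r s : F,
      [/\ B r, B s,
          henselian_over (in_alg F) A B r,
          henselian_over (in_alg F) A B s
        & adjoin_set (in_alg F) A [set eta; r; s] b].
Proof.
have [A_subring A_total] := A_val; pose R := subring_elt A_subring.
pose i : {rmorphism R -> L} := @incl L A A_subring.
pose f : {rmorphism R -> Ls} := iota \o i.
pose O := integral_elements f.
rewrite (integral_closureE A_subring) -/O in Astar_def m_max.
have [m_ideal _ _] := m_max.
have m1 := maximal_ideal_proper m_max; have m_prime := maximal_ideal_prime m_max.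
have m_unit :=
  maximal_ideal_lies_over m_max (@valuation_ring_local _ _ A_subring A_total).
pose evF (p : {poly L}) := (map_poly (in_alg F) p).[eta].
have j_map (p : {poly L}) x :
    j (map_poly (in_alg F) p).[x] = (map_poly iota p).[j x].
  rewrite -horner_map -map_poly_comp; congr (_.[_]).
  by apply: eq_map_poly => c /=; rewrite j_iota.
have j_evF p : j (evF p) = (map_poly iota p).[j eta] by apply: j_map.
have evF_onto y : exists p, y = evF p.
  have : y \in <<1; eta>>%VS by rewrite F_gen memvf.
  by case/Fadjoin_polyP => _ /polyOver1P[p ->] ->; exists p.
have OM x y : O x -> O y -> O (x * y) by apply: integral_mul.
have O1 : O 1 by apply: integral1.
have O_evR (p : {poly R}) x : O x -> O (map_poly iota (map_poly i p)).[x].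
  by rewrite -map_poly_comp; apply: integral_map_horner.
have AstarE x : Astar x = O (j x) by rewrite Astar_def.
have B_frac x y : O (j x) -> O (j y) -> ~ m (j y) -> B (x / y).
  by move=> Ox Oy my; rewrite B_def; exists x, y; split; rewrite ?AstarE.
have B_O x : O (j x) -> B x.
  by move=> Ox; rewrite -(divr1 x); apply: B_frac; rewrite ?rmorph1.
have B_unit x : O (j x) -> ~ m (j x) -> unit_of B x.
  move=> Ox mx; have x0 : x != 0.
    by apply/eqP => x0; case: mx; rewrite x0 rmorph0; case: m_ideal.
  split; [exact: B_O | exists x^-1; rewrite ?divff //].
  by rewrite -(mul1r x^-1); apply: B_frac; rewrite ?rmorph1.
(* From [x * (a / s) = 1] comes [s = x * a]: were [x] in [m], the denominator [s] would be too. *)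
have unit_notin_m x : O (j x) -> unit_of B x -> ~ m (j x).
  move=> Ox [_ [y]]; rewrite B_def => -[a [s [Sa Ss ms ->]]] xas1 mx.
  have s0 : s != 0.
    by apply/eqP => s0; case: ms; rewrite /= s0 rmorph0; case: m_ideal.
  case: ms; rewrite /= (_ : s = x * a); last first.
    by rewrite -[s]mul1r -xas1 mulrA divfK.
  by rewrite rmorphM; apply: (idealMr m_ideal) => //; move: Sa; rewrite AstarE.
have h_monic : h \is monic.
  by rewrite -(map_monic (in_alg F)) h_minPoly monic_minPoly.
have [hR hRE] := lift_polyOver A_subring h_A.
have hR_monic : hR \is monic by rewrite -monic_map_incl hRE.
have h_eta : evF h = 0 by rewrite /evF h_minPoly; apply/rootP/root_minPoly.
have h_jeta : root (map_poly iota h) (j eta).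
  by apply/rootP; rewrite -j_evF h_eta rmorph0.
have root_h_O z : root (map_poly iota h) z -> O z.
  by move=> hz; exists hR => //; rewrite map_poly_comp hRE.
have O_eta : O (j eta) by apply: root_h_O.
have dh_O : O (j (evF h^`())) by rewrite j_evF -hRE deriv_map; apply: O_evR.
have m_dh := unit_notin_m _ dh_O dh_unit.
(* Separability follows from [h'(eta)] being nonzero, since it is not in [m]. *)
have h_sep : separable_poly (map_poly iota h).
  rewrite separable_map -(separable_map (in_alg F)) h_minPoly.
  rewrite -[separable_poly _]/(separable_element 1 eta).
  have := separable_root_der 1 eta; case: separable_element => //=.
  rewrite -h_minPoly deriv_map => /rootP dh0; case: m_dh.
  by rewrite [evF _]dh0 rmorph0; case: m_ideal.
have [rs0 hrs0] := separably_closed_split Ls_sep.2 (monic_map iota h_monic) h_sep.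
have eta_rs0 : j eta \in rs0 by rewrite -root_prod_XsubC -hrs0.
pose rs := seq.rem (j eta) rs0.
have hE : map_poly iota h = \prod_(z <- j eta :: rs) ('X - z%:P).
  by rewrite hrs0; apply: perm_big; apply: perm_to_rem.
have rs_uniq : uniq (j eta :: rs).
  by rewrite -(perm_uniq (perm_to_rem eta_rs0)) -separable_prod_XsubC -hrs0.
have rs_root z : z \in j eta :: rs -> root (map_poly iota h) z.
  by rewrite hE root_prod_XsubC.
have rs_O z : z \in j eta :: rs -> O z by move/rs_root/root_h_O.
have h_dvd (p : {poly L}) : evF p = 0 -> h %| p.
  move=> p0; rewrite -(dvdp_map (in_alg F)) h_minPoly.
  by apply: minPoly_dvdp; [apply/polyOver1P; exists p | apply/rootP].
(* Every conjugate of an element g(eta) of A* is integral over A, so that the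
   remainder of g h' modulo h has its coefficients in A. *)
have dh_Astar y : O (j y) -> exists p : {poly R}, evF (map_poly i p) = y * evF h^`().
  have [g ->] := evF_onto y; case=> p p_monic; rewrite map_poly_comp j_evF => pg0.
  (* [p(g(eta)) = 0] makes [h] divide [p \Po g], so [p] annihilates every conjugate [g(z)]. *)
  have h_pg : h %| map_poly i p \Po g.
    apply: h_dvd; apply: (fmorph_inj j); rewrite j_evF rmorph0 map_comp_poly.
    by rewrite horner_comp; apply/rootP.
  have g_O z : z \in j eta :: rs -> O (map_poly iota g).[z].
    move=> /rs_root hz; exists p => //; rewrite map_poly_comp.
    have : root (map_poly iota (map_poly i p \Po g)) z.
      rewrite -dvdp_XsubCl (dvdp_trans _ (_ : map_poly iota h %| _)) ?dvdp_map //.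
      by rewrite dvdp_XsubCl.
    by rewrite map_comp_poly /root horner_comp.
  have /= coef_int := integral_modp_deriv rs_uniq hE rs_O g_O.
  have /lift_polyOver-/(_ A_subring)[q qE] : (g * h^`()) %% h \is a polyOver [in A].
    rewrite -[_ %% _]coefK; apply: polyOver_poly => k _; apply/mem_set.
    apply: (valuation_ring_integrally_closed A_total).
    have [q q_monic] := coef_int k.
    by rewrite map_poly_comp fmorph_root => qk; exists q.
  exists q; rewrite [map_poly i q]qE /evF -hornerM -rmorphM.
  rewrite [in RHS](divp_eq (g * h^`()) h) rmorphD rmorphM /= hornerD hornerM.
  by rewrite -/(evF h) h_eta mulr0 add0r.
move=> b Bb.
have [a [s [Sa Ss ms bE]]] : localization Astar (j @^-1` m) b by rewrite -B_def.
rewrite !AstarE in Sa Ss.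
(* Expanding the fraction [b = a / s] by [h'(eta)] gives [b = p1(eta) / u(eta)]. *)
have [p1 p1E] := dh_Astar a Sa; have [u uE] := dh_Astar s Ss.
have m_u : ~ m (map_poly f u).[j eta].
  rewrite map_poly_comp -j_evF uE rmorphM => /m_prime[] //.
(* [h'(eta)] is the product of the [eta - z]; a factor in [m] would put it in [m]. *)
have m_rs z : z \in rs -> ~ m (j eta - z).
  move=> z_rs m_z; apply: m_dh.
  rewrite j_evF -deriv_map hE big_cons derivM derivXsubC !hornerE subrr mul0r addr0.
  rewrite (big_rem z) //= hornerM !hornerE; apply: (idealMr m_ideal) => //.
  rewrite horner_prod big_seq; apply: (big_ind O) => // t t_rs.
  rewrite !hornerE; apply: integral_sub => //; apply: rs_O.
  by rewrite inE (mem_rem t_rs) orbT.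
have [||w m_uw w_rs] :=
  multiple_with_distinct_values
    m_ideal m1 m_prime m_unit (rs := rs) O_eta _ _ m_rs m_u.
- exact: unit_notin_m.
- by move=> z z_rs; apply: rs_O; rewrite inE z_rs orbT.
have hRsE : map_poly f hR = \prod_(z <- j eta :: rs) ('X - z%:P).
  by rewrite map_poly_comp [map_poly i _]hRE.
(* The roots of [P] are the values of [u * w] at the roots of [h]; [a1] is the one at [eta]. *)
have [P P_monic PE] := poly_of_root_values (u * w) hR_monic rs_uniq hRsE.
pose a1 := evF (map_poly i (u * w)).
have ja1 : j a1 = (map_poly f (u * w)).[j eta] by rewrite j_evF -map_poly_comp.
have O_a1 : O (j a1) by rewrite ja1; apply: integral_map_horner.
have a1_n0 : a1 != 0.
  apply/eqP => a10; apply: m_uw; rewrite -ja1 a10 rmorph0.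
  by case: m_ideal.
pose PL := map_poly i P.
have j_PL : (map_poly j (map_poly (in_alg F) PL)) = map_poly f P.
  rewrite -!map_poly_comp; apply: eq_map_poly => c /=; exact: j_iota.
have P_a1 : root (map_poly (in_alg F) PL) a1.
  by rewrite -(fmorph_root j) j_PL PE big_cons ja1 rootM root_XsubC eqxx.
(* [P'(a1)] is the product of the differences of [a1] with the other values, none in [m].
   Integrality is carried along because primality of [m] is stated for elements of [O]. *)
have m_dP : ~ m (j (map_poly (in_alg F) PL)^`().[a1]).
  rewrite -horner_map -deriv_map j_PL PE big_cons ja1 derivM derivXsubC !hornerE.
  rewrite subrr mul0r addr0 horner_prod big_seq.
  apply: (big_ind (fun x => O x /\ ~ m x) _ _ _).2 => //.
  - by move=> x y [Ox mx] [Oy my]; split; [exact: OM | case/m_prime].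
  move=> z z_rs; rewrite !hornerE; split; last exact: w_rs.
  apply: integral_sub; first by rewrite -ja1.
  by apply: integral_map_horner; apply: rs_O; rewrite inE z_rs orbT.
have r_B : B a1^-1.
  rewrite -(mul1r a1^-1); apply: B_frac; rewrite ?rmorph1 //.
  by rewrite ja1.
have r_hens : henselian_over (in_alg F) A B a1^-1.
  have a1_exp n : O (j (a1 ^+ n)) /\ ~ m (j (a1 ^+ n)).
    elim: n => [|n [On mn]]; first by rewrite rmorph1.
    by rewrite exprS rmorphM; split; [exact: OM | case/m_prime => //; rewrite ja1].
  have PL_rev : map_poly (in_alg F) (reverse_poly PL) =
                reverse_poly (map_poly (in_alg F) PL).
    by apply: map_reverse_poly; apply: fmorph_inj.
  exists (reverse_poly PL); split.
  - rewrite /PL -map_reverse_poly; first exact: polyOver_map_incl.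
    exact: incl_inj.
  - rewrite PL_rev.
    apply: (mulfI (expf_neq0 (size (map_poly (in_alg F) PL)).-1 a1_n0)).
    by rewrite horner_reverse_poly // mulr0; apply/rootP.
  (* The derivative at [1/a1] is [v / a1 ^+ n] with [v = - a1 ^+ 2 * P'(a1)]; numerator and
     denominator are integral and outside [m], so it is a unit of [B]. *)
  rewrite -deriv_map PL_rev.
  have := horner_deriv_reverse_poly a1_n0 P_a1.
  set n := (size _).-1; set d := _.[a1^-1]; set v := - _ * _ => dv.
  have [O_n m_n] := a1_exp n.
  have [O_v m_v] : O (j v) /\ ~ m (j v).
    have [O_2 m_2] := a1_exp 2%N.
    have O_dP : O (j (map_poly (in_alg F) PL)^`().[a1]).
      by rewrite deriv_map j_map deriv_map ja1; apply: O_evR; rewrite -ja1.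
    rewrite /v mulNr rmorphN rmorphM; split; first exact/integral_opp/OM.
    by move=> /(idealN m_ideal); rewrite opprK => /m_prime[].
  have a1n0 : a1 ^+ n != 0 by apply: expf_neq0.
  have v0 : v != 0.
    by apply/eqP => v0; case: m_v; rewrite v0 rmorph0; case: m_ideal.
  have -> : d = v / a1 ^+ n by rewrite -dv mulrC mulKf.
  split; first exact: B_frac.
  by exists (a1 ^+ n / v); [exact: B_frac | rewrite mulrA divfK // divff].
exists a1^-1, a1^-1; split=> //.
(* [adjoin_set] is the intersection of all subrings [T] containing the generators. *)
move=> T [T_subring T_gen].
have T_A (c : R) : T (i c)%:A.
  by apply: T_gen; left; exists (i c) => //; apply: inclP.
have T_eta : T eta by apply: T_gen; right; left; left.
have T_r : T a1^-1 by apply: T_gen; right; right.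
have T_mul x y : T x -> T y -> T (x * y).
  move=> /mem_set Tx /mem_set Ty; case: T_subring => _ _ TM.
  by apply/set_mem/TM.
have T_evF (p : {poly R}) : T (evF (map_poly i p)).
  have T_add x y : T x -> T y -> T (x + y).
    have [_ TD] := GRing.zmod_closedD (GRing.subring_closedB T_subring).
    by move=> /mem_set Tx /mem_set Ty; apply/set_mem/TD.
  elim/poly_ind: p => [|p c IHp].
    by rewrite /evF !rmorph0 horner0 -(scale0r 1) -(rmorph0 i).
  rewrite /evF !rmorphD !rmorphM /= !map_polyX !map_polyC !hornerE.
  by apply: T_add; [apply: T_mul | apply: T_A].
(* The factor [w(eta)] cancels, as [a1 = u(eta) * w(eta)]. *)
suff -> : b = evF (map_poly i p1) * evF (map_poly i w) * a1^-1.
  by do 2!apply: (T_mul) => //.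
have s0 : s != 0.
  by apply/eqP => s0; apply: ms; rewrite /= s0 rmorph0; case: m_ideal.
have a1E : a1 = s * evF h^`() * evF (map_poly i w).
  by rewrite -uE /a1 /evF rmorphM rmorphM hornerM.
have := a1_n0; rewrite a1E !mulf_eq0 !negb_or => /andP[/andP[_ d0] w0].
by rewrite bE p1E; field; rewrite s0 d0 w0.
Qed.
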